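(* Let $\mathcal M:\mathcal H\rightrightarrows\mathcal H$ be maximal monotone and let $S\subset\mathcal H$ be a linear subspace. Fix brackets, i.e. subspaces $S_0\subset S\subset S_1$ of $\mathcal H$, fix $c>0$, and fix self-adjoint positive definite $A:S_0\to S_0$ and $C:S_1^\perp\to S_1^\perp$. The corresponding semidefinite progressive decoupling step is implementable if and only if $\mathcal A_*=(\mathcal M^\#)_*$ is maximal monotone on $H_*:=S_0\oplus S_1^\perp$.
   Context: $\mathcal H$ is a finite-dimensional Hilbert space; $P_V$ is the orthogonal projection onto a subspace $V$. Spingarn's partial inverse $\mathcal A=\mathcal M^\#$ with respect to $S$: $(x^\#,u^\#)\in\operatorname{gph}\mathcal A$ if and only if some $(z,w)\in\operatorname{gph}\mathcal M$ satisfies $x^\#=P_Sz+P_{S^\perp}w$ and $u^\#=P_Sw+P_{S^\perp}z$. Let $K_0:=S\cap S_0^\perp$, $K_1:=S^\perp\cap S_1$, $H_{**}:=K_0\oplus K_1$, so that $\mathcal H=H_*\oplus H_{**}$ orthogonally, and let $B:=AP_{S_0}+C^{-1}P_{S_1^\perp}$, a self-adjoint positive semidefinite operator with range $H_*$ and kernel $H_{**}$. The semidefinite progressive decoupling step associated with the brackets and $(c,A,C)$ is the semidefinite proximal step for $\mathcal A$: given $x\in\mathcal H$, find $x^+\in\mathcal H$ with $0\in\mathcal A(x^+)+c^{-1}B(x^+-x)$. It is implementable if for every $x\in\mathcal H$ this inclusion has at least one solution $x^+\in\mathcal H$. Writing elements of $\mathcal H$ as $(x_*,x_{**})$ relative to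 $\mathcal H=H_*\oplus H_{**}$, the projected mapping $\mathcal A_*:H_*\rightrightarrows H_*$ is defined by $u_*\in\mathcal A_*(x_* )\iff\exists x_{**}\in H_{**}$ such that $(u_*,0)\in\mathcal A(x_*,x_{**})$. *)

(* Defs.v *)
From HB Require Import structures.
From mathcomp Require Import all_boot all_order all_algebra.
From mathcomp Require Import classical_sets reals.

Set Implicit Arguments.
Unset Strict Implicit.
Unset Printing Implicit Defensive.

Import Order.TTheory GRing.Theory Num.Theory.

Local Open Scope classical_set_scope.
Local Open Scope ring_scope.

(* A finite-dimensional real Hilbert space is a [vectType R] together with an
   inner product [dot : {dot H for idfun}]; completeness is automatic.
   Linear subspaces are elements of [{vspace H}]; a subspace [V] is a Hilbert
   space of its own as the type [subvs_of V] with the inner product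
   [subdot dot V]. *)

Section Subspaces.
Variables (R : realType) (H : vectType R) (dot : {dot H for idfun}).
Implicit Types (V : {vspace H}) (x : H).

(* [daddv_pi V W] projects onto [V] along [W] when [V] and [W] are
   supplementary; see [orthoprojP]. *)
Definition orthoproj V : 'End(H) := daddv_pi V (orthov dot V).

Lemma capv_orthov V : (V :&: orthov dot V = 0)%VS.
Proof.
apply/eqP; rewrite -subv0; apply/subvP => v; rewrite memv_cap memv0.
case/andP=> vV /mem_orthovP/(_ v vV) vv0; apply/negPn/negP => v_neq0.
by have := neq0_dnorm_gt0 (s := dot) v v_neq0; rewrite vv0 ltxx.
Qed.

Lemma addv_orthov V : (V + orthov dot V = fullv)%VS.
Proof.
apply/eqP; rewrite eqEdim subvf /= dimv_disjoint_sum ?capv_orthov//.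
rewrite /orthov; move: (\dim V) (tval (vbasis V)) => n s.
elim: n => [|n IHn]; first by rewrite big_ord0 add0n.
apply: leq_trans IHn _; rewrite addSnnS leq_add2l big_ord_recr/=.
set U := (\bigcap_(_ < _) _)%VS; set f := linfun _.
rewrite -(limg_ker_dim f U) -addn1 leq_add2l.
by apply: leq_trans (dimvS (subvf _)) _; rewrite dimvf.
Qed.

Lemma orthoprojP V x :
  orthoproj V x \in V /\ x - orthoproj V x \in orthov dot V.
Proof.
split; first exact: memv_pi.
rewrite -{1}[x](@daddv_pi_add _ _ V (orthov dot V)) ?capv_orthov//.
  by rewrite addrC addKr memv_pi.
by rewrite addv_orthov memvf.
Qed.

(* [vsproj V] alone would project along an arbitrary complement of [V]. *)
Definition orthoproj_sub V x : subvs_of V := vsproj V (orthoproj V x).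

Definition subdot V (u v : subvs_of V) : R := dot (vsval u) (vsval v).

Fact subdot_bilinear V :
  bilinear_for *%R (idfun \; *%R) (@subdot V : subvs_of V -> subvs_of V -> R).
Proof.
split=> w a u v; rewrite /subdot linearP//=.
exact: (linearPl dot).
Qed.

HB.instance Definition _ V :=
  @bilinear_isBilinear.Build R _ _ _ _ _ (@subdot V) (subdot_bilinear V).

Fact subdot_hermitian V (u v : subvs_of V) :
  subdot u v = (-1) ^+ false * idfun (subdot v u).
Proof. exact: (hermitian_subproof (s := dot)). Qed.

HB.instance Definition _ V :=
  @isHermitianSesquilinear.Build R _ _ _ (@subdot V) (@subdot_hermitian V).

Fact subdot_gt0 V (u : subvs_of V) : u != 0 -> 0 < subdot u u.
Proof.
move=> u_neq0; apply: (neq0_dnorm_gt0 (s := dot)).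
by apply: contra u_neq0 => /eqP u0; apply/eqP/subvs_inj; rewrite u0 linear0.
Qed.

HB.instance Definition _ V :=
  @isDotProduct.Build R _ (@subdot V) (@subdot_gt0 V).

End Subspaces.
Arguments subdot {R H} dot V u v.

Section Operators.
Variables (R : realType) (H : vectType R) (dot : {dot H for idfun}).

Definition self_adjoint (f : 'End(H)) := forall u v, dot (f u) v = dot u (f v).

Definition positive_definite (f : 'End(H)) :=
  forall u, u != 0 -> 0 < dot (f u) u.

(* A set-valued mapping [T : H ==> H] is a function [T : H -> set H]. *)
Definition gph (T : H -> set H) : set (H * H) := [set p | T p.1 p.2].

Definition monotone (T : H -> set H) :=
  forall p q, gph T p -> gph T q -> 0 <= dot (p.1 - q.1) (p.2 - q.2).

Definition maximal_monotone (T : H -> set H) :=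
  monotone T /\
  forall T', monotone T' -> gph T `<=` gph T' -> gph T' = gph T.

Definition partial_inverse (S : {vspace H}) (M : H -> set H) : H -> set H :=
  fun x => [set u | exists z w, [/\ gph M (z, w),
    x = orthoproj dot S z + orthoproj dot (orthov dot S) w &
    u = orthoproj dot S w + orthoproj dot (orthov dot S) z]].

Definition prox_step (T : H -> set H) (c : R) (B : H -> H) (x x' : H) :=
  [set u + c^-1 *: B (x' - x) | u in T x'] 0.

(* Here [H] is meant to be the orthogonal direct sum of [V] and [W], and the
   pair (x, y) of components stands for the vector [vsval x + vsval y]. *)
Definition projected_map (V W : {vspace H}) (T : H -> set H) :
    subvs_of V -> set (subvs_of V) :=
  fun x => [set u | exists y : subvs_of W, gph T (vsval x + vsval y, vsval u)].

End Operators.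
Arguments partial_inverse {R H} dot S M _ _.
Arguments projected_map {R H} V W T _ _.

Section ProgressiveDecoupling.
Variables (R : realType) (H : vectType R) (dot : {dot H for idfun}).
Variables S S0 S1 : {vspace H}.

Definition Hstar : {vspace H} := (S0 + orthov dot S1)%VS.

Definition Hstarstar : {vspace H} :=
  ((S :&: orthov dot S0) + (orthov dot S :&: S1))%VS.

(* [(C^-1)%VF] is the inverse of [C] as soon as [C] is bijective, in particular
   when [C] is positive definite. *)
Definition stepB (A : 'End(subvs_of S0)) (C : 'End(subvs_of (orthov dot S1)))
    (x : H) : H :=
  vsval (A (orthoproj_sub dot S0 x)) +
  vsval ((C^-1)%VF (orthoproj_sub dot (orthov dot S1) x)).

Definition implementable (M : H -> set H) (c : R) (A : 'End(subvs_of S0))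
    (C : 'End(subvs_of (orthov dot S1))) :=
  forall x, exists x',
    prox_step (partial_inverse dot S M) c (stepB A C) x x'.

End ProgressiveDecoupling.
Arguments Hstar {R H} dot S0 S1.
Arguments Hstarstar {R H} dot S S0 S1.
Arguments stepB {R H} dot {S0 S1} A C x.
Arguments implementable {R H} dot S {S0 S1} M c A C.

(* Main.v *)
(* Let [P] be the restriction of [c^-1 B] to [H_*]. As [B] has range [H_*] and
   kernel [H_**], a step from a point with [H_*]-component [w] amounts to finding
   [x] in [H_*] such that [P (w - x)] belongs to [A_*] at [x]: implementability
   says that the resolvent of [A_*] in the metric of [P] is defined everywhere.
   Since [A_*] is monotone as soon as [M] is, this is Minty's characterization of
   maximality.

   The substantial half of Minty's theorem is to find [x] such that
   [<x - y, (w - x) - v> >= 0] for all [(y, v)] in the graph. Expanding, each graph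
   point asks [|x|^2 - 2 <x, m> + k <= 0] for a pair [(m, k)], and monotonicity
   puts the convex hull of these pairs below the paraboloid [k = |m|^2]. The point
   [x] is the limit of the components [m] of pairs in that hull which nearly
   maximize the strictly concave function [k - |m|^2]. *)
From HB Require Import structures.
Require Import Defs.
From mathcomp Require Import all_boot all_order all_algebra.
From mathcomp Require Import classical_sets reals.
From mathcomp Require Import boolp ring lra.

Set Implicit Arguments.
Unset Strict Implicit.
Unset Printing Implicit Defensive.

Import Order.TTheory GRing.Theory Num.Theory.

Local Open Scope ring_scope.

(** * Completeness of the reals and of finite-dimensional spaces *)

Lemma nested_intervals (R : realType) (I : Type) (a d : I -> R) :
  (forall i j, `|a i - a j| <= d i + d j) ->
  exists r, forall i, `|a i - r| <= d i.
Proof.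
(* The intervals of centre [a i] and radius [d i] meet pairwise, so every left endpoint is below
   every right one; the supremum of the left endpoints lies in all of them. *)
move=> ad; pose L := [set a i - d i | i in [set: I]]%classic.
have Lub i : ubound L (a i + d i).
  move=> _ [j _ <-]; have := ad j i; have := ler_norm (a j - a i); lra.
exists (sup L) => i; have Li : L (a i - d i) by exists i.
have L0 : L !=set0%classic by exists (a i - d i).
have := ge_sup L0 (Lub i); have : a i - d i <= sup L.
  by apply: ub_le_sup Li; exists (a i + d i).
by move=> h1 h2; rewrite ler_norml; apply/andP; split; lra.
Qed.

Section InnerProduct.
Variables (R : realType) (H : vectType R) (dot : {dot H for idfun}).
Implicit Types (x y u v : H).

Lemma dotC u v : dot u v = dot v u.
Proof. by rewrite (hermitian_subproof (s := dot) u v) expr0 mul1r. Qed.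

Lemma dotDl u v w : dot (u + v) w = dot u w + dot v w.
Proof. exact: linearDl. Qed.

Lemma dotNl u w : dot (- u) w = - dot u w.
Proof. exact: linearNl. Qed.

Lemma dotZl a u w : dot (a *: u) w = a * dot u w.
Proof. exact: linearZl_LR. Qed.

Lemma dotDr u v w : dot u (v + w) = dot u v + dot u w.
Proof. exact: linearDr. Qed.

Lemma dotNr u w : dot u (- w) = - dot u w.
Proof. exact: linearNr. Qed.

Lemma dotZr a u w : dot u (a *: w) = a * dot u w.
Proof. exact: (linearZr_LR dot). Qed.

Definition dotE := (dotDl, dotDr, dotNl, dotNr, dotZl, dotZr).

Lemma dot_ge0 u : 0 <= dot u u.
Proof.
have [->|u0] := eqVneq u 0; first by rewrite -(scale0r 0) dotZl mul0r.
exact/ltW/(neq0_dnorm_gt0 (s := dot)).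
Qed.

Lemma dot_eq0 u : dot u u <= 0 -> u = 0.
Proof.
move=> uu; apply/eqP/negPn/negP => /(neq0_dnorm_gt0 (s := dot)).
by rewrite ltNge uu.
Qed.

(** Completeness without sequences, [d i] being the error of [u i]. Induction on the dimension: the
    coefficients along one vector [e] form nested intervals, and each such direction adds 1 to [K].
    [K = 1] would not do in general: three mutually tangent discs have no common point. *)
Lemma dot_complete (I : Type) (u : I -> H) (d : I -> R) :
  (forall i, 0 <= d i) ->
  (forall i j, dot (u i - u j) (u i - u j) <= (d i + d j) ^+ 2) ->
  exists x K, forall i, dot (u i - x) (u i - x) <= K * d i ^+ 2.
Proof.
move=> d0.
suff main n : forall (V : {vspace H}) (w : I -> H), (\dim V <= n)%N ->
    (forall i, w i \in V) ->
    (forall i j, dot (w i - w j) (w i - w j) <= (d i + d j) ^+ 2) ->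
    exists x K, forall i, dot (w i - x) (w i - x) <= K * d i ^+ 2.
  by apply: (main _ fullv) => // i; rewrite memvf.
elim: n => [|n IHn] V w dimV wV wd.
  move: dimV; rewrite leqn0 dimv_eq0 => /eqP V0; exists 0, 0 => i.
  move: (wV i); rewrite V0 memv0 => /eqP->.
  by rewrite subrr -(scale0r 0) dotZl !mul0r.
have [V0|Vn0] := eqVneq V 0%VS.
  by apply: (IHn V) => //; rewrite V0 dimv0.
have := memv_pick V; set e := vpick V => eV.
have e0 : e != 0 by rewrite vpick0.
have ee0 : 0 < dot e e := neq0_dnorm_gt0 (s := dot) e e0.
pose a i := dot (w i) e / dot e e; pose z i := w i - a i *: e.
have ze i : dot (z i) e = 0.
  by rewrite /z /a !dotE; field; rewrite gt_eqF.
have zE i : w i = a i *: e + z i by rewrite addrC subrK.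
have zV i : z i \in V by rewrite rpredB ?rpredZ.
clearbody a z.
have pyth i (b : R) y : dot y e = 0 ->
    dot (w i - (b *: e + y)) (w i - (b *: e + y)) =
    (a i - b) ^+ 2 * dot e e + dot (z i - y) (z i - y).
  move=> ye; rewrite zE !dotE (dotC e (z i)) (dotC e y) (dotC y (z i)) ye ze.
  ring.
have split i j : (a i - a j) ^+ 2 * dot e e + dot (z i - z j) (z i - z j)
    <= (d i + d j) ^+ 2.
  by rewrite -pyth // -zE wd.
pose q := Num.sqrt (dot e e).
have q0 : 0 < q by rewrite sqrtr_gt0.
have qq : q ^+ 2 = dot e e by rewrite sqr_sqrtr // ltW.
have [r ar] : exists r, forall i, `|a i - r| <= d i / q.
  apply: nested_intervals => i j.
  rewrite -mulrDl ler_pdivlMr // -ler_sqr ?nnegrE;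
    rewrite ?addr_ge0 ?mulr_ge0 ?(ltW q0) //.
  rewrite exprMn qq real_normK ?num_real //.
  by have := split i j; have := dot_ge0 (z i - z j); lra.
have [y [K yK]] : exists y K, forall i, dot (z i - y) (z i - y) <= K * d i ^+ 2.
  apply: (IHn (V :&: orthov dot <[e]>)%VS).
  - rewrite -ltnS; apply: leq_trans dimV; rewrite ltnNge; apply/negP => le.
    have VE : (V :&: orthov dot <[e]>)%VS = V.
      by apply/eqP; rewrite eqEdim capvSl.
    have : e \in orthov dot <[e]> by move: eV; rewrite -VE memv_cap => /andP[].
    by rewrite mem_orthov1 gt_eqF.
  - by move=> i; rewrite memv_cap zV mem_orthov1; apply/eqP; exact: ze.
  - move=> i j; apply: le_trans (split i j).
    by rewrite ler_wpDl // mulr_ge0 ?sqr_ge0 ?dot_ge0.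
(* The point [y] may have a component along [e]; dropping it only brings [y] closer to the [z i],
   which are orthogonal to [e]. *)
have [y' [t [yE y'e]]] : exists y' t, y = y' + t *: e /\ dot y' e = 0.
  exists (y - (dot y e / dot e e) *: e), (dot y e / dot e e).
  by rewrite subrK; split=> //; rewrite !dotE; field; rewrite gt_eqF.
have y'K i : dot (z i - y') (z i - y') <= K * d i ^+ 2.
  apply: le_trans (yK i); rewrite yE -subr_ge0 !dotE.
  rewrite (dotC e (z i)) (dotC e y') ze y'e.
  by have := mulr_ge0 (sqr_ge0 t) (ltW ee0); lra.
exists (r *: e + y'), (1 + K) => i.
rewrite pyth // mulrDl mul1r lerD // -qq -exprMn.
rewrite -[leLHS]real_normK ?num_real //.
rewrite ler_sqr ?nnegrE // normrM (gtr0_norm q0) -ler_pdivlMr //.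
Qed.

(** * Convex separation and the Debrunner-Flor inequality *)

(** The conclusion places [E] below the tangent hyperplane at [x] of the paraboloid [k = dot m m],
    which separates [E] from the epigraph of the squared norm. *)
Lemma convex_below_paraboloid (E : H -> R -> Prop) :
  (forall m k m' k' t, E m k -> E m' k' -> 0 <= t <= 1 ->
    E (t *: m + (1 - t) *: m') (t * k + (1 - t) * k')) ->
  (forall m k, E m k -> k <= dot m m) ->
  exists x, forall m k, E m k -> dot x x - dot x m *+ 2 + k <= 0.
Proof.
move=> convE Ele.
pose G m k : R := k - dot m m.
have [[m0 [k0 E0]]|noE] := pselect (exists m k, E m k); last first.
  by exists 0 => m k Emk; case: noE; exists m, k.
pose L := [set r | exists m k, E m k /\ r = G m k]%classic.
have L0 : L !=set0%classic by exists (G m0 k0), m0, k0.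
have L_le0 : ubound L 0 by move=> _ [m [k [/Ele kle ->]]]; rewrite subr_le0.
pose s := sup L.
have s_le0 : s <= 0 by apply: ge_sup.
have Gs m k : E m k -> G m k <= s.
  by move=> Emk; apply: ub_le_sup; [exists 0 | exists m, k].
have G_conv m k m' k' t : G (t *: m + (1 - t) *: m') (t * k + (1 - t) * k') =
    t * G m k + (1 - t) * G m' k' + t * (1 - t) * dot (m - m') (m - m').
  by rewrite /G !dotE (dotC m' m); ring.
have Gconv_le m k m' k' t : E m k -> E m' k' -> 0 <= t <= 1 ->
    t * G m k + (1 - t) * G m' k' + t * (1 - t) * dot (m - m') (m - m') <= s.
  by move=> Em Em' t01; rewrite -G_conv Gs //; apply: convE.
pose I := {p : H * R | E p.1 p.2}.
(* The factor 2 fits the midpoint case of [Gconv_le], which bounds the squared distance of two first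
   components by [d p ^+ 2 + d p' ^+ 2]. *)
pose d (p : I) := Num.sqrt ((s - G (sval p).1 (sval p).2) *+ 2).
have d2 p : d p ^+ 2 = (s - G (sval p).1 (sval p).2) *+ 2.
  by rewrite sqr_sqrtr // mulrn_wge0 // subr_ge0 Gs //; case: p.
have d0 p : 0 <= d p by rewrite sqrtr_ge0.
have [x [K xK]] : exists x K, forall p : I,
    dot ((sval p).1 - x) ((sval p).1 - x) <= K * d p ^+ 2.
  apply: dot_complete => // p p'.
  have -> : (d p + d p') ^+ 2 = d p ^+ 2 + d p' ^+ 2 + d p * d p' *+ 2 by ring.
  rewrite !d2; have := mulr_ge0 (d0 p) (d0 p').
  case: p p' => [[m k] /= Em] [[m' k'] /= Em'].
  by have /= := @Gconv_le m k m' k' 2^-1 Em Em' _; lra.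
exists x => m k Em; apply: le_trans s_le0.
set l := dot (m - x) (m - x).
have -> : dot x x - dot x m *+ 2 + k = G m k + l.
  by rewrite /G /l !dotE (dotC m x); ring.
rewrite leNgt; apply/negP; set D := G m k + l => sD.
have l0 : 0 <= l := dot_ge0 _.
(* If [s < D], moving by the small fraction [t] from a near-maximizer towards
   [(m, k)] would raise [G] above [s]. *)
pose t := (D - s) / (D - s + l *+ 4).
have Dl0 : 0 < D - s + l *+ 4 by lra.
have t0 : 0 < t by rewrite divr_gt0 // subr_gt0.
have tge0 : 0 <= t := ltW t0.
have t1 : t <= 1 by rewrite ler_pdivrMr //; lra.
have tE : t * (D - s + l *+ 4) = D - s by rewrite divfK // gt_eqF.
clearbody t.
have {}xK m' k' : E m' k' ->
    dot (m' - x) (m' - x) <= K *+ 2 * (s - G m' k').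
  move=> Em'; have /= := xK (exist _ (m', k') Em').
  by rewrite d2 /=; lra.
(* The right-hand side becomes arbitrarily small as [G m' k'] approaches [s], whereas the left-hand
   side is a fixed number, shown below to be positive. *)
have key m' k' : E m' k' ->
    t * (D - s) - t ^+ 2 * l *+ 2 <= (1 + `|K| *+ 2) * (s - G m' k').
  move=> Em'; have b_le : dot (m' - x) (m' - x) <= `|K| *+ 2 * (s - G m' k').
    apply: le_trans (xK _ _ Em') _; rewrite ler_wpM2r ?subr_ge0 ?Gs //.
    by rewrite lerMn2r ler_norm orbT.
  (* A weighted Young inequality: for [a = m - x] and [b = m' - x], the two sides differ by
     [|t a - b|^2 + t |b|^2]. *)
  have tab : t * (1 - t) * l - dot (m' - x) (m' - x) <=
      t * dot (m - m') (m - m').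
    have -> : m - m' = (m - x) - (m' - x) by rewrite opprB addrA subrK.
    rewrite /l; move: (m - x) (m' - x) => a b; rewrite -subr_ge0.
    have -> : t * dot (a - b) (a - b) - (t * (1 - t) * dot a a - dot b b) =
        dot (t *: a - b) (t *: a - b) + t * dot b b.
      by rewrite !dotE (dotC b a); ring.
    by rewrite addr_ge0 ?(mulr_ge0 tge0) ?dot_ge0.
  have := Gconv_le m k m' k' t Em Em'; rewrite t1 tge0 => /(_ isT).
  rewrite [t * (1 - t) * dot _ _]mulrAC.
  move: (t * dot _ _) (dot _ _) tab b_le => ee bb tab b_le.
  have e0 : 0 <= s - G m' k' by rewrite subr_ge0 Gs.
  have h1 : 0 <= (1 - t) * (ee - (t * (1 - t) * l - bb)).
    by rewrite mulr_ge0 // subr_ge0.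
  have h2 : 0 <= t * (t * (t * l)) by rewrite !mulr_ge0.
  have h3 : 0 <= t * (s - G m' k') by rewrite mulr_ge0.
  have h4 : 0 <= (1 - t) * (`|K| *+ 2 * (s - G m' k') - bb).
    by rewrite mulr_ge0 // subr_ge0.
  have h5 : 0 <= t * (`|K| *+ 2 * (s - G m' k')).
    by rewrite !mulr_ge0 ?mulrn_wge0.
  rewrite /D; lra.
have K1 : 0 < 1 + `|K| *+ 2 by rewrite ltr_wpDr // mulrn_wge0.
pose eta := t * (D - s) - t ^+ 2 * l *+ 2.
(* By [tE], [4 t l = (1 - t) (D - s) <= D - s], so [eta] is at least [t (D - s) / 2]. *)
have eta0 : 0 < eta.
  have -> : eta = t * (D - s - t * l *+ 2) by rewrite /eta; ring.
  by rewrite mulr_gt0 //; have := mulr_gt0 t0 (_ : 0 < D - s); lra.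
have supL : has_sup L by split=> //; exists 0.
have [_ [m' [k' [Em' ->]]]] := sup_adherent (divr_gt0 eta0 K1) supL.
have := key _ _ Em'; rewrite -/s -/eta mulrC -ler_pdivrMr //; lra.
Qed.

Lemma debrunner_flor (T : H -> set H) (w : H) : monotone dot T ->
  exists x, forall y v, T y v -> 0 <= dot (x - y) (w - x - v).
Proof.
move=> monT.
(* The supremum of [F a b y v (dot y v)] over the graph is the Fitzpatrick function of [T] at
   [(a, b)]. *)
pose F (a b y v : H) (k : R) : R := dot a v + dot y b - k.
(* The closed convex hull, enlarged upwards in [k], of the triples
   [(y, v, <y, v>)] with [v] in [T y], described by affine inequalities so that
   no finite convex combination is needed. *)
pose hull y v k := forall a b r,
  (forall y' v', T y' v' -> F a b y' v' (dot y' v') <= r) -> F a b y v k <= r.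
(* By monotonicity a graph point [(y', v')] is a test pair with bound [dot y' v']. Applied to the
   hull point, this makes [(y, v)] itself a test pair with bound [k], and testing the hull point by
   it gives [2 <y, v> - k <= k]. *)
have hull_ge y v k : hull y v k -> dot y v <= k.
  move=> hk; have : F y v y v k <= k; last by rewrite /F; lra.
  apply: (hk) => y' v' Ty'v'.
  have : F y' v' y v k <= dot y' v'; last by rewrite /F; lra.
  apply: hk => y2 v2 Ty2v2; have /= := monT (y', v') (y2, v2) Ty'v' Ty2v2.
  by rewrite /F !dotE; lra.
(* For [k' = dot y v], the number [dot (x - y) (w - x - v)] is the opposite of
   [|x|^2 - 2 <x, m> + k]. *)
pose E m k := exists y v k',
  [/\ hull y v k', m = 2^-1 *: (y + w - v) & k = dot y w - k'].
have [||x xE] := @convex_below_paraboloid E.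
- move=> _ _ _ _ t [y [v [k [h -> ->]]]] [y' [v' [k' [h' -> ->]]]].
  move=> /andP[t0 t1].
  exists (t *: y + (1 - t) *: y'), (t *: v + (1 - t) *: v').
  exists (t * k + (1 - t) * k').
  split.
  + move=> a b r hr.
    have := mulr_ge0 t0 (_ : 0 <= r - F a b y v k).
    rewrite subr_ge0 => /(_ (h _ _ _ hr)).
    have := mulr_ge0 (_ : 0 <= 1 - t) (_ : 0 <= r - F a b y' v' k').
    rewrite !subr_ge0 => /(_ t1 (h' _ _ _ hr)).
    by rewrite /F !dotE; lra.
  + rewrite !scalerA ![_ * 2^-1]mulrC -!scalerA -scalerDr; congr (_ *: _).
    have wE : t *: w + (1 - t) *: w = w.
      by rewrite -scalerDl addrC subrK scale1r.
    by rewrite -[in RHS]wE !scalerDr !scalerN opprD addrACA [X in X + _]addrACA.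
  + by rewrite !dotE; ring.
(* The gap to the paraboloid is [|y - w + v|^2 / 4] plus [k - dot y v], nonnegative by [hull_ge]. *)
- move=> _ _ [y [v [k [/hull_ge h -> ->]]]].
  have := dot_ge0 (y - w + v); rewrite !dotE.
  rewrite (dotC w y) (dotC v y) (dotC v w); lra.
exists x => y v Tyv.
have /xE : E (2^-1 *: (y + w - v)) (dot y w - dot y v).
  by exists y, v, (dot y v); split=> // a b r; apply.
rewrite !dotE (dotC y x); lra.
Qed.

(** Adjoining [(x, u)] to the graph keeps it monotone, so by maximality it was there already. *)
Lemma maximal_monotone_mem (T : H -> set H) (x u : H) :
  maximal_monotone dot T ->
  (forall y v, T y v -> 0 <= dot (x - y) (u - v)) -> T x u.
Proof.
case=> monT maxT xuT.
pose T' y := [set v | T y v \/ y = x /\ v = u]%classic.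
suff TT' : gph T' = gph T by rewrite -[T x u]/(gph T (x, u)) -TT'; right.
apply: maxT; last by move=> p; left.
case=> [y v] [y' v'] [Tyv|[/= -> ->]] [Ty'v'|[/= -> ->]] /=.
- exact: (monT (y, v) (y', v')).
- by have := xuT _ _ Tyv; rewrite !dotE; lra.
- exact: xuT.
- by rewrite subrr -(scale0r 0) dotZl mul0r.
Qed.

End InnerProduct.

(** * Minty's characterization in the metric of [P] *)

Section Metric.
Variables (R : realType) (H : vectType R) (dot : {dot H for idfun}).
Variable P : 'End(H).

(** The two proofs are arguments so that the inner product structure can be inferred from the
    term. *)
Definition metric of self_adjoint dot P & positive_definite dot P :=
  fun u v => dot (P u) v.

Hypotheses (saP : self_adjoint dot P) (pdP : positive_definite dot P).

Fact metric_bilinear :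
  bilinear_for *%R (idfun \; *%R) (metric saP pdP : H -> H -> R).
Proof. by split=> w a u v; rewrite /metric ?linearP /= ?dotE. Qed.

HB.instance Definition _ :=
  @bilinear_isBilinear.Build R _ _ _ _ _ (metric saP pdP) metric_bilinear.

Fact metric_hermitian (u v : H) :
  metric saP pdP u v = (-1) ^+ false * idfun (metric saP pdP v u).
Proof. by rewrite /metric expr0 mul1r saP dotC. Qed.

HB.instance Definition _ :=
  @isHermitianSesquilinear.Build R _ _ _ (metric saP pdP) metric_hermitian.

HB.instance Definition _ := @isDotProduct.Build R _ (metric saP pdP) pdP.

Lemma positive_definite_lker0 : lker P == 0%VS.
Proof.
rewrite -subv0; apply/subvP => u; rewrite memv_ker memv0 => /eqP Pu0.
by apply/negPn/negP => /pdP; rewrite Pu0 -(scale0r 0) dotZl mul0r ltxx.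
Qed.

Lemma positive_definiteVK : cancel (P^-1)%VF P.
Proof.
by apply: lker0_lfunVK; exact: positive_definite_lker0.
Qed.

Lemma self_adjoint_inv : self_adjoint dot (P^-1)%VF.
Proof.
move=> u v; rewrite -[v in LHS]positive_definiteVK.
by rewrite -saP positive_definiteVK.
Qed.

Lemma positive_definite_inv : positive_definite dot (P^-1)%VF.
Proof.
move=> u u0; rewrite -[u in X in _ < X]positive_definiteVK.
rewrite lker0_lfunK ?positive_definite_lker0 // dotC; apply: pdP.
apply: contraNneq u0 => Vu0.
by rewrite -(positive_definiteVK u) Vu0 linear0.
Qed.

(** In the metric of [P], the map [T'], which is [P^-1] after [T], is monotone; the Debrunner-Flor
    point for it satisfies the hypothesis of [maximal_monotone_mem] for [T]. *)
Lemma minty (T : H -> set H) (w : H) : maximal_monotone dot T ->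
  exists x, T x (P (w - x)).
Proof.
move=> maxT; pose T' x := [set u | T x (P u)]%classic.
have monT' : monotone (metric saP pdP) T'.
  move=> p q Tp Tq; rewrite /= /metric saP linearB.
  exact: (maxT.1 (p.1, P p.2) (q.1, P q.2)).
have [x xT'] := debrunner_flor w monT'; exists x.
apply: (maximal_monotone_mem maxT) => y v Tyv.
have := xT' y ((P^-1)%VF v); rewrite /T'/= positive_definiteVK => /(_ Tyv).
by rewrite /metric saP linearB /= positive_definiteVK.
Qed.

(** For [(x, u)] in a monotone extension, solve at [w = x + P^-1 u]. The solution [x'] has value
    [u + P (x - x')], so monotonicity forces [x' = x] and the value is [u]. *)
Lemma surj_maximal_monotone (T : H -> set H) : monotone dot T ->
  (forall w, exists x, T x (P (w - x))) -> maximal_monotone dot T.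
Proof.
move=> monT surjT; split=> // T' monT' subT.
apply/seteqP; split=> // -[x u] T'xu.
have [x' Tx'] := surjT (x + (P^-1)%VF u).
suff xx' : x = x'.
  by move: Tx'; rewrite -xx' addrC addKr positive_definiteVK.
have /= := monT' (x, u) (x', _) T'xu (subT (x', _) Tx').
have -> : u - P (x + (P^-1)%VF u - x') = - P (x - x').
  by rewrite addrAC linearD /= positive_definiteVK opprD addrCA subrr addr0.
rewrite dotNr dotC oppr_ge0.
move=> le0; apply/eqP; rewrite -subr_eq0; apply/negPn/negP => /pdP.
by rewrite ltNge le0.
Qed.

End Metric.

(** * Orthogonal projections and the partial inverse *)

Section Orthoproj.
Variables (R : realType) (H : vectType R) (dot : {dot H for idfun}).
Implicit Types (V W : {vspace H}) (x y u v : H).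

Lemma orthoproj_in V x : orthoproj dot V x \in V.
Proof. exact: (orthoprojP dot V x).1. Qed.

Lemma orthov_dot V u v : u \in orthov dot V -> v \in V -> dot u v = 0.
Proof. by move=> /mem_orthovP; apply. Qed.

Lemma orthoproj_uniq V x y : y \in V -> x - y \in orthov dot V ->
  orthoproj dot V x = y.
Proof.
move=> yV xyV; have [pV xpV] := orthoprojP dot V x.
apply/eqP; rewrite -subr_eq0 -memv0 -(capv_orthov dot V) memv_cap rpredB //=.
suff -> : orthoproj dot V x - y = (x - y) - (x - orthoproj dot V x).
  by rewrite rpredB.
by rewrite opprB [RHS]addrC addrA subrK.
Qed.

Lemma orthoproj_eq0 V x : x \in orthov dot V -> orthoproj dot V x = 0.
Proof. by move=> xV; apply: orthoproj_uniq; rewrite ?subr0 ?mem0v. Qed.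

Lemma orthoproj_compl V x :
  orthoproj dot (orthov dot V) x = x - orthoproj dot V x.
Proof.
have [pV xpV] := orthoprojP dot V x; apply: orthoproj_uniq => //.
rewrite subKr; apply/mem_orthovP => v /orthov_dot h.
by apply: etrans (dotC dot _ _) (h _ _).
Qed.

Lemma dot_orthoproj V x v : v \in V -> dot (orthoproj dot V x) v = dot x v.
Proof.
move=> vV; apply/esym/eqP; rewrite -subr_eq0 -dotNl -dotDl.
by apply/eqP; apply: orthov_dot vV; exact: (orthoprojP dot V x).2.
Qed.

Lemma orthov_orthov V x : x \in orthov dot (orthov dot V) -> x \in V.
Proof.
move=> /orthoproj_eq0/eqP; rewrite orthoproj_compl subr_eq0 => /eqP->.
exact: orthoproj_in.
Qed.

(** Exchanging the components along the complement of [S] preserves the inner product of the two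
    differences: [<Pa + Qb, Pb + Qa> = <a, b>] for the projections [P] on [S] and [Q] on its
    complement. *)
Lemma partial_inverse_monotone (S : {vspace H}) (M : H -> set H) :
  monotone dot M -> monotone dot (partial_inverse dot S M).
Proof.
rewrite /monotone /gph /partial_inverse; move: (orthoproj_compl S).
move: (orthoproj dot (orthov dot S)) => Q QE monM.
move=> [_ _] [_ _] [z [w [Mzw /= -> ->]]] [z' [w' [Mzw' /= -> ->]]].
have := monM (z, w) (z', w') Mzw Mzw' => /=; rewrite !QE.
have ort a b : dot (orthoproj dot S a) (b - orthoproj dot S b) = 0.
  rewrite dotC; apply: orthov_dot; last exact: orthoproj_in.
  exact: (orthoprojP dot S b).2.
have regroup a a' b b' : orthoproj dot S a + (b - orthoproj dot S b) -
    (orthoproj dot S a' + (b' - orthoproj dot S b')) =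
    orthoproj dot S (a - a') + (b - b' - orthoproj dot S (b - b')).
  by rewrite !linearB /= !opprD addrACA; congr (_ + _); rewrite addrACA.
move: (ort (z - z') (w - w')) (ort (w - w') (z - z')).
move: (ort (z - z') (z - z')) (ort (w - w') (w - w')).
rewrite !regroup; move: (z - z') (w - w') => a b.
move: (orthoproj dot S a) (orthoproj dot S b) => p q.
rewrite !dotE (dotC dot q b) (dotC dot b p) (dotC dot q p) (dotC dot b a); lra.
Qed.

End Orthoproj.

(** * The operator [B] and its restriction to [H_*] *)

Section ProgressiveDecoupling.
Variables (R : realType) (H : vectType R) (dot : {dot H for idfun}).
Variables S S0 S1 : {vspace H}.
Hypotheses (S0S : (S0 <= S)%VS) (SS1 : (S <= S1)%VS).

Lemma vsval_orthoproj_sub (V : {vspace H}) x :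
  vsval (orthoproj_sub dot V x) = orthoproj dot V x.
Proof. by rewrite vsprojK // orthoproj_in. Qed.

Lemma orthoproj_sub_linear (V : {vspace H}) : linear (orthoproj_sub dot V).
Proof. by move=> a x y; rewrite /orthoproj_sub !linearP. Qed.

HB.instance Definition _ V :=
  @GRing.isLinear.Build R H (subvs_of V) _ _ (orthoproj_sub_linear V).

(** As [S0] lies in [S] and the complement of [S1] in that of [S], orthogonality to each summand of
    [H_*] constrains just one of the components of [x] along [S] and its complement. *)
Lemma orthov_HstarE : orthov dot (Hstar dot S0 S1) = Hstarstar dot S S0 S1.
Proof.
apply/eqP; rewrite eqEsubv; apply/andP; split; apply/subvP => x.
  move=> /orthov_dot xorth.
  have x0 v : v \in S0 -> dot x v = 0.
    by move=> vS; apply: xorth; apply: subvP vS; exact: addvSl.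
  have x1 v : v \in orthov dot S1 -> dot x v = 0.
    by move=> vS; apply: xorth; apply: subvP vS; exact: addvSr.
  have pxK : x = orthoproj dot S x + orthoproj dot (orthov dot S) x.
    by rewrite orthoproj_compl addrC subrK.
  rewrite {}pxK memv_add // memv_cap orthoproj_in /=.
    apply/mem_orthovP => v vS0; apply: etrans (x0 _ vS0).
    by apply: dot_orthoproj; apply: subvP vS0.
  apply: orthov_orthov; apply/mem_orthovP => v vS1; apply: etrans (x1 _ vS1).
  apply: dot_orthoproj; apply/mem_orthovP => s sS.
  by apply: orthov_dot vS1 _; apply: subvP sS.
move=> /memv_addP[a + [b + ->]]; rewrite !memv_cap.
move=> /andP[aS aS0] /andP[bS bS1].
apply/mem_orthovP => _ /memv_addP[v vS0 [v' v'S1 ->]].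
have a0 : dot a v = 0 := orthov_dot aS0 vS0.
have a1 : dot a v' = 0.
  by apply: etrans (dotC dot _ _) _; apply: orthov_dot v'S1 _; apply: subvP aS.
have b0 : dot b v = 0 by apply: orthov_dot bS _; apply: subvP vS0.
have b1 : dot b v' = 0.
  by apply: etrans (dotC dot _ _) _; apply: orthov_dot v'S1 _.
apply: etrans (dotDl dot _ _ _) _; rewrite !dotDr a0 a1 b0 b1; ring.
Qed.

Variables (c : R) (A : 'End(subvs_of S0)) (C : 'End(subvs_of (orthov dot S1))).
Hypotheses (c0 : 0 < c)
  (saA : self_adjoint (subdot dot S0) A)
  (pdA : positive_definite (subdot dot S0) A)
  (saC : self_adjoint (subdot dot (orthov dot S1)) C)
  (pdC : positive_definite (subdot dot (orthov dot S1)) C).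

Lemma stepB_linear : linear (stepB dot A C).
Proof.
by move=> a x y; rewrite /stepB !linearP /= scalerDr addrACA.
Qed.

HB.instance Definition _ :=
  @GRing.isLinear.Build R H H _ _ stepB_linear.

Lemma stepB_Hstar x : stepB dot A C x \in Hstar dot S0 S1.
Proof. by apply: memv_add; apply: subvsP. Qed.

Lemma stepB_Hstarstar x : x \in Hstarstar dot S S0 S1 -> stepB dot A C x = 0.
Proof.
rewrite -orthov_HstarE => /orthov_dot xorth.
rewrite /stepB /orthoproj_sub !orthoproj_eq0 ?linear0 ?addr0 //;
  apply/mem_orthovP => v vS; apply: xorth; apply: subvP vS.
  exact: addvSr.
exact: addvSl.
Qed.

Lemma dot_stepB x y : dot (stepB dot A C x) y =
  subdot dot S0 (A (orthoproj_sub dot S0 x)) (orthoproj_sub dot S0 y) +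
  subdot dot (orthov dot S1) ((C^-1)%VF (orthoproj_sub dot (orthov dot S1) x))
    (orthoproj_sub dot (orthov dot S1) y).
Proof.
rewrite /stepB dotDl /subdot !vsval_orthoproj_sub.
by congr (_ + _); rewrite dotC -(dot_orthoproj _ _ (subvsP _)) dotC.
Qed.

(** Here [vsproj] merely changes the type, since the values of [B] lie in [H_*]. *)
Definition Bstar : 'End(subvs_of (Hstar dot S0 S1)) :=
  linfun (vsproj (Hstar dot S0 S1) \o (c^-1 \*: stepB dot A C) \o vsval).

Lemma vsval_Bstar u : vsval (Bstar u) = c^-1 *: stepB dot A C (vsval u).
Proof. by rewrite lfunE /= vsprojK // rpredZ // stepB_Hstar. Qed.

Lemma Bstar_self_adjoint : self_adjoint (subdot dot (Hstar dot S0 S1)) Bstar.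
Proof.
move=> u v.
change (dot (vsval (Bstar u)) (vsval v) = dot (vsval u) (vsval (Bstar v))).
rewrite !vsval_Bstar dotZl dotZr (dotC dot (vsval u)).
congr (_ * _); rewrite !dot_stepB; congr (_ + _).
  exact: etrans (saA _ _) (dotC (subdot dot S0) _ _).
exact: etrans (self_adjoint_inv saC pdC _ _) (dotC (subdot dot _) _ _).
Qed.

Lemma Bstar_positive_definite :
  positive_definite (subdot dot (Hstar dot S0 S1)) Bstar.
Proof.
move=> u u0; change (0 < dot (vsval (Bstar u)) (vsval u)).
rewrite vsval_Bstar dotZl mulr_gt0 ?invr_gt0 // dot_stepB.
have nonneg (V : {vspace H}) (P : 'End(subvs_of V)) :
    positive_definite (subdot dot V) P -> forall w, 0 <= subdot dot V (P w) w.
  move=> pdP w; have [->|/pdP/ltW//] := eqVneq w 0; rewrite linear0.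
  exact: (dot_ge0 (subdot dot V) 0).
have pdC' := positive_definite_inv pdC.
have [p0|p0] := eqVneq (orthoproj_sub dot S0 (vsval u)) 0; last first.
  exact: ltr_pwDl (pdA p0) (nonneg _ _ pdC' _).
have [p1|p1] := eqVneq (orthoproj_sub dot (orthov dot S1) (vsval u)) 0;
  last first.
  exact: ltr_wpDl (nonneg _ _ pdA _) (pdC' _ p1).
(* If both projections vanish, then [u], a sum of a vector of [S0] and one orthogonal to [S1], is
   orthogonal to itself. *)
case/eqP: u0; apply/val_inj/(@dot_eq0 _ _ dot); rewrite /=.
have /memv_addP[a aS [b bS uE]] := subvsP u.
rewrite {2}uE dotDr -(dot_orthoproj _ _ aS) -(dot_orthoproj _ _ bS).
rewrite -!vsval_orthoproj_sub p0 p1 !linear0.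
by rewrite -(scale0r 0) !dotZl !mul0r addr0.
Qed.

End ProgressiveDecoupling.

(** * The projected mapping and the equivalence *)

(** The components in [W] are orthogonal to the values, which lie in [V], and so contribute nothing
    to the inner product. *)
Lemma projected_map_monotone (R : realType) (H : vectType R)
    (dot : {dot H for idfun}) (V W : {vspace H}) (T : H -> set H) :
  (W <= orthov dot V)%VS -> monotone dot T ->
  monotone (subdot dot V) (projected_map V W T).
Proof.
move=> WV monT [x u] [x' u'] [y Txy] [y' Txy']; rewrite /=.
change (0 <= dot (vsval (x - x')) (vsval (u - u'))).
rewrite ![vsval (_ - _)]linearB /=.
have := monT (_, _) (_, _) Txy Txy'; rewrite /= opprD addrACA dotDl.
suff -> : dot (vsval y - vsval y') (vsval u - vsval u') = 0 by rewrite addr0.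
apply: (@orthov_dot _ _ dot V); last by rewrite rpredB ?subvsP.
by apply: (subvP WV); rewrite rpredB ?subvsP.
Qed.

Theorem corollary5p3 (R : realType) (H : vectType R) (dot : {dot H for idfun})
    (M : H -> set H) (S S0 S1 : {vspace H}) (c : R)
    (A : 'End(subvs_of S0)) (C : 'End(subvs_of (orthov dot S1))) :
  maximal_monotone dot M ->
  (S0 <= S)%VS -> (S <= S1)%VS ->
  0 < c ->
  self_adjoint (subdot dot S0) A ->
  positive_definite (subdot dot S0) A ->
  self_adjoint (subdot dot (orthov dot S1)) C ->
  positive_definite (subdot dot (orthov dot S1)) C ->
  implementable dot S M c A C <->
  maximal_monotone (subdot dot (Hstar dot S0 S1))
    (projected_map (Hstar dot S0 S1) (Hstarstar dot S S0 S1)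
       (partial_inverse dot S M)).
Proof.
move=> [monM _] S0S SS1 c0 saA pdA saC pdC.
set V := Hstar dot S0 S1; set W := Hstarstar dot S S0 S1.
set T := partial_inverse dot S M; set P := Bstar c A C.
have VW : orthov dot V = W by exact: orthov_HstarE.
have saP : self_adjoint (subdot dot V) P by exact: Bstar_self_adjoint.
have pdP : positive_definite (subdot dot V) P by exact: Bstar_positive_definite.
(* Since [B] vanishes on [W], only the components in [V] enter the proximal term. *)
have stepE (x' w : subvs_of V) (y z : H) : y \in W -> z \in W ->
    c^-1 *: stepB dot A C (vsval x' + y - (vsval w + z)) = - vsval (P (w - x')).
  move=> yW zW; rewrite vsval_Bstar.
  have -> : vsval x' + y - (vsval w + z) = - vsval (w - x') + (y - z).
    by rewrite [vsval (_ - _)]linearB /= opprB opprD addrACA.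
  rewrite [stepB _ _ _ (_ + _)]linearD /= linearN.
  by rewrite (stepB_Hstarstar S0S SS1) ?rpredB // addr0 scalerN.
split=> [impl|maxT w].
  apply: (surj_maximal_monotone pdP).
    apply: projected_map_monotone; rewrite ?VW //.
    exact: partial_inverse_monotone.
  (* A step from a point of [V] suffices; the component of its solution in [W] is the witness
     required by the projected mapping. *)
  move=> w; have [x' [u Tx'u]] := impl (vsval w).
  have [xV xW] := orthoprojP dot V x'; rewrite VW in xW.
  have x'E :
      x' = vsval (vsproj V (orthoproj dot V x')) + (x' - orthoproj dot V x').
    by rewrite vsprojK // addrC subrK.
  rewrite {1}x'E -[vsval w]addr0 stepE ?mem0v // => /subr0_eq uE.
  exists (vsproj V (orthoproj dot V x')), (vsproj W (x' - orthoproj dot V x')).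
  by rewrite -uE [vsval (vsproj W _)]vsprojK // -x'E.
have [wV wW] := orthoprojP dot V w; rewrite VW in wW.
have [x [y Txy]] := minty saP pdP (vsproj V (orthoproj dot V w)) maxT.
exists (vsval x + vsval y).
exists (vsval (P (vsproj V (orthoproj dot V w) - x))) => //.
have := stepE x (vsproj V (orthoproj dot V w)) _ _ (subvsP y) wW.
by rewrite vsprojK // [_ + (w - _)]addrC subrK => ->; rewrite subrr.
Qed.
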